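(* Let $t$ be a closed term. If $\Phi$ is a derivation in the CbV type system of $\Gamma\vdash^{(m,e)} t:M$, then there is $s$ and an evaluation sequence $d\colon t\to_{\mathrm{cbv}}^{*} s$ with $\mathrm{normal}_{\mathrm{cbv}}(s)$, $|d|_m\leq m$ and $|d|_e\leq e$. Moreover, if $\Phi$ is tight then $|d|_m=m$ and $|d|_e=e$.
   Context: Terms: $t,s ::= x \mid \lambda x.t \mid t\,s \mid t[x\leftarrow s]$, where $t[x\leftarrow s]$ (explicit substitution) binds $x$ in $t$; values $v ::= \lambda x.t$. $\mathrm{fv}(t[x\leftarrow s])=(\mathrm{fv}(t)\setminus\{x\})\cup\mathrm{fv}(s)$; closed means no free variables; terms up to $\alpha$-equivalence. Contexts: CbV (= weak) contexts $V ::= \langle\cdot\rangle \mid V t \mid V[x\leftarrow t] \mid t V \mid t[x\leftarrow V]$; substitution contexts $S ::= \langle\cdot\rangle \mid S[x\leftarrow t]$; $V\langle t\rangle$ plugging (may capture), $V\langle\langle t\rangle\rangle$ plugging where $V$ does not capture free variables of $t$. Root steps: $S\langle\lambda x.t\rangle s\mapsto_m S\langle t[x\leftarrow s]\rangle$ (variables bound by $S$ disjoint from $\mathrm{fv}(s)$); $V\langle\langle x\rangle\rangle[x\leftarrow S\langle v\rangle]\mapsto_e S\langle V\langle\langle v\rangle\rangle[x\leftarrow v]\rangle$ (variables bound by $S$ disjoint from $\mathrm{fv}(V\langle\langle x\rangle\rangle)$). $\to_{m,\mathrm{cbv}}$ (resp. $\to_{e,\mathrm{cbv}}$) relates $V\langle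 t'\rangle$ to $V\langle s'\rangle$ for any CbV context $V$ when $t'\mapsto_m s'$ (resp. $\mapsto_e$); $\to_{\mathrm{cbv}}$ is their union. $|d|_m,|d|_e$ count multiplicative and exponential steps of $d$. $\mathrm{normal}_{\mathrm{cbv}}$: least predicate with $\mathrm{normal}_{\mathrm{cbv}}(\lambda x.t)$ and ($\mathrm{normal}_{\mathrm{cbv}}(t)$ and $\mathrm{normal}_{\mathrm{cbv}}(s)$) $\Rightarrow\mathrm{normal}_{\mathrm{cbv}}(t[x\leftarrow s])$. CbV types: linear types $L ::= M\to N$; multi types $M,N ::= [L_i]_{i\in J}$ finite multisets, $\mathbf 0$ empty multiset, $\uplus$ union. Type contexts $\Gamma$ map variables to multi types, all but finitely many to $\mathbf 0$; $\mathrm{dom}(\Gamma)=\{x\mid\Gamma(x)\ne\mathbf 0\}$; empty if domain empty; $\uplus$ pointwise; $\Gamma,x:M$ means $\Gamma\uplus(x\mapsto M)$ with $x\notin\mathrm{dom}(\Gamma)$. Rules: (ax) $x:M\vdash^{(0,1)} x:M$ for any multi type $M$; (app) from $\Gamma\vdash^{(m,e)} t:[M\to N]$ and $\Pi\vdash^{(m',e')} s:M$ infer $\Gamma\uplus\Pi\vdash^{(m+m'+1,e+e')} t\,s:N$; (fun) from $\Gamma,x:N\vdash^{(m,e)} t:M$ infer $\Gamma\vdash^{(m,e)}\lambda x.t:N\to M$; (many) from $\Pi_i\vdash^{(m_i,e_i)}\lambda x.t:L_i$ for $i\in J$ ($J$ finite, possibly empty) infer $\biguplus_i\Pi_i\vdash^{(\sum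 m_i,\sum e_i)}\lambda x.t:[L_i]_{i\in J}$; (ES) from $\Gamma,x:N\vdash^{(m,e)} t:M$ and $\Pi\vdash^{(m',e')} s:N$ infer $\Gamma\uplus\Pi\vdash^{(m+m',e+e')} t[x\leftarrow s]:M$. A derivation of $\Gamma\vdash^{(m,e)} t:M$ is tight if $M=\mathbf 0$ and $\Gamma$ is empty. *)

(* Defs.v *)
From HB Require Import structures.
From mathcomp Require Import all_boot.
From mathcomp Require Import finmap multiset.

Set Implicit Arguments.
Unset Strict Implicit.
Unset Printing Implicit Defensive.

(* finmap leaves its own scope on top of nat_scope. *)
Local Open Scope nat_scope.

(* Terms up to alpha-equivalence are de Bruijn terms: [Lam t] and [ES t s]
   (that is, t[x<-s]) bind index 0 in [t]; [s] is outside the scope of x. *)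
Inductive term : Type :=
| Var of nat
| Lam of term
| App of term & term
| ES of term & term.

(* [shift k c t] adds [k] to the free indices >= [c] of [t]. *)
Fixpoint shift (k c : nat) (t : term) : term :=
  match t with
  | Var i => Var (if i < c then i else i + k)
  | Lam t => Lam (shift k c.+1 t)
  | App t s => App (shift k c t) (shift k c s)
  | ES t s => ES (shift k c.+1 t) (shift k c s)
  end.

Fixpoint fv (t : term) (x : nat) : bool :=
  match t with
  | Var y => x == y
  | Lam t => fv t x.+1
  | App t s => fv t x || fv s x
  | ES t s => fv t x.+1 || fv s x
  end.

Definition closed_term (t : term) : Prop := forall x, ~~ fv t x.

Inductive is_value : term -> Prop :=
| value_lam t : is_value (Lam t).

Inductive cctx : Type :=
| CHole
| CAppL of cctx & term
| CESL of cctx & term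
| CAppR of term & cctx
| CESR of term & cctx.

Inductive sctx : Type :=
| SHole
| SES of sctx & term.

(* Capturing plugging V<t>, S<t>: indices are left unchanged. *)
Fixpoint cplug (V : cctx) (t : term) : term :=
  match V with
  | CHole => t
  | CAppL V s => App (cplug V t) s
  | CESL V s => ES (cplug V t) s
  | CAppR s V => App s (cplug V t)
  | CESR s V => ES s (cplug V t)
  end.

Fixpoint splug (C : sctx) (t : term) : term :=
  match C with
  | SHole => t
  | SES C s => ES (splug C t) s
  end.

(* Number of variables bound by the context at its hole. *)
Fixpoint cdepth (V : cctx) : nat :=
  match V with
  | CHole => 0
  | CAppL V _ => cdepth V
  | CESL V _ => (cdepth V).+1
  | CAppR _ V => cdepth V
  | CESR _ V => cdepth V
  end.

Fixpoint sdepth (C : sctx) : nat :=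
  match C with
  | SHole => 0
  | SES C _ => (sdepth C).+1
  end.

Fixpoint cshift (k c : nat) (V : cctx) : cctx :=
  match V with
  | CHole => CHole
  | CAppL V t => CAppL (cshift k c V) (shift k c t)
  | CESL V t => CESL (cshift k c.+1 V) (shift k c t)
  | CAppR t V => CAppR (shift k c t) (cshift k c V)
  | CESR t V => CESR (shift k c.+1 t) (cshift k c V)
  end.

(* Non-capturing plugging V<<t>>: the indices of [t] refer to the outside of
   [V]. *)
Definition cplug_nc (V : cctx) (t : term) : term :=
  cplug V (shift (cdepth V) 0 t).

(* Moving a term under the binders of [S] shifts it by [sdepth S]; this is what
   the disjointness side conditions on named terms amount to. *)
Inductive root_m : term -> term -> Prop :=
| RootM S t s :
    root_m (App (splug S (Lam t)) s)
           (splug S (ES t (shift (sdepth S) 0 s))).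

(* The x of V<<x>>[x<-S<v>] is index 0 just outside [V].  In the reduct, [V] is
   moved under the binders of [S] (which leaves x = 0 fixed), and the copy of [v]
   substituted for x is also moved under the binder of x. *)
Inductive root_e : term -> term -> Prop :=
| RootE V S v :
    is_value v ->
    root_e (ES (cplug_nc V (Var 0)) (splug S v))
           (splug S (ES (cplug_nc (cshift (sdepth S) 1 V) (shift 1 0 v)) v)).

Inductive cbv_m : term -> term -> Prop :=
| CbvM V t s : root_m t s -> cbv_m (cplug V t) (cplug V s).

Inductive cbv_e : term -> term -> Prop :=
| CbvE V t s : root_e t s -> cbv_e (cplug V t) (cplug V s).

Inductive cbv_seq : term -> term -> Type :=
| SeqNil t : cbv_seq t t
| SeqM t u s : cbv_m t u -> cbv_seq u s -> cbv_seq t s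
| SeqE t u s : cbv_e t u -> cbv_seq u s -> cbv_seq t s.

Fixpoint count_m t s (d : cbv_seq t s) : nat :=
  match d with
  | SeqNil _ => 0
  | SeqM _ _ _ _ d => (count_m d).+1
  | SeqE _ _ _ _ d => count_m d
  end.

Fixpoint count_e t s (d : cbv_seq t s) : nat :=
  match d with
  | SeqNil _ => 0
  | SeqM _ _ _ _ d => count_e d
  | SeqE _ _ _ _ d => (count_e d).+1
  end.

Inductive normal_cbv : term -> Prop :=
| NormalLam t : normal_cbv (Lam t)
| NormalES t s : normal_cbv t -> normal_cbv s -> normal_cbv (ES t s).

(* Linear types have to satisfy L ::= M -> N with M, N finite multisets of linear
   types.  They are built from raw types, where multisets are lists, by keeping
   only the raw types whose lists are hereditarily sorted for a fixed total order,
   so that each hereditary multiset has exactly one representative.  The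
   representation is only meant to be used through the constructor [Arr] and the
   facts [Arr_inj], [Arr_surj] and [lty_ind] below. *)
Inductive rawty : Type := RArr of seq rawty & seq rawty.

Fixpoint rawty_enc (r : rawty) : GenTree.tree unit :=
  let: RArr M N := r in
  GenTree.Node 0 [:: GenTree.Node 0 (map rawty_enc M);
                     GenTree.Node 0 (map rawty_enc N)].

Fixpoint rawty_dec (g : GenTree.tree unit) : rawty :=
  match g with
  | GenTree.Node _ [:: GenTree.Node _ a; GenTree.Node _ b] =>
      RArr (map rawty_dec a) (map rawty_dec b)
  | _ => RArr [::] [::]
  end.

Fixpoint rawty_all (P : rawty -> Prop) (s : seq rawty) : Prop :=
  if s is r :: s' then P r /\ rawty_all P s' else True.

Lemma rawty_nested_ind (P : rawty -> Prop) :
  (forall M N, rawty_all P M -> rawty_all P N -> P (RArr M N)) ->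
  forall r, P r.
Proof.
move=> IH; fix rec 1; case=> M N; apply: IH.
- by elim: M => //= r M IHM; split.
- by elim: N => //= r N IHN; split.
Qed.

Lemma rawty_encK : cancel rawty_enc rawty_dec.
Proof.
elim/rawty_nested_ind => M N HM HN /=.
have E s : rawty_all (fun r => rawty_dec (rawty_enc r) = r) s ->
  map rawty_dec (map rawty_enc s) = s.
  by elim: s => //= r s IHs [-> /IHs ->].
by rewrite !E.
Qed.

HB.instance Definition _ := Equality.copy rawty (can_type rawty_encK).
HB.instance Definition _ := Choice.copy rawty (can_type rawty_encK).
HB.instance Definition _ := CanIsCountable rawty_encK.

Definition rawty_le (r s : rawty) : bool := choice.pickle r <= choice.pickle s.

Lemma rawty_le_total : total rawty_le.
Proof. by move=> r s; apply: leq_total. Qed.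

Lemma rawty_le_trans : transitive rawty_le.
Proof. by move=> s r u; apply: leq_trans. Qed.

Lemma rawty_le_anti : antisymmetric rawty_le.
Proof.
move=> r s; rewrite /rawty_le -eqn_leq => /eqP E.
by apply: (pcan_inj (@choice.pickleK rawty)).
Qed.

Fixpoint canonical (r : rawty) : bool :=
  let: RArr M N := r in
  [&& sorted rawty_le M, sorted rawty_le N, all canonical M & all canonical N].

Record lty : Type := Lty { raw_of : rawty; raw_ofP : canonical raw_of }.

HB.instance Definition _ := [isSub of lty for raw_of].
HB.instance Definition _ := [Countable of lty by <:].

Notation mty := {mset lty}%mset.

Definition raw_mset (M : mty) : seq rawty :=
  sort rawty_le (map raw_of (enum_mset M)).

Lemma all_canonical_raw (s : seq lty) : all canonical (map raw_of s).
Proof. by elim: s => //= L s ->; rewrite raw_ofP. Qed.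

Lemma canonical_Arr (M N : mty) : canonical (RArr (raw_mset M) (raw_mset N)).
Proof.
by rewrite /= !(sort_sorted rawty_le_total) !all_sort !all_canonical_raw.
Qed.

Definition Arr (M N : mty) : lty := Lty (canonical_Arr M N).

Lemma raw_mset_inj : injective raw_mset.
Proof.
move=> M N /(perm_sortP rawty_le_total rawty_le_trans rawty_le_anti) E.
rewrite -[M]seq_mset_id -[N]seq_mset_id; apply/eq_seq_msetP.
exact: (perm_map_inj (@val_inj _ _ lty) E).
Qed.

Lemma Arr_inj M N M' N' : Arr M N = Arr M' N' -> M = M' /\ N = N'.
Proof. by case=> /raw_mset_inj -> /raw_mset_inj ->. Qed.

Lemma raw_mset_surj s : sorted rawty_le s -> all canonical s ->
  exists M, raw_mset M = s.
Proof.
move=> Hs Hc; exists (seq_mset (pmap insub s)).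
have E : map raw_of (pmap insub s : seq lty) = s.
  elim: s {Hs} Hc => //= r s IHs /andP[Hr /IHs Es].
  by rewrite insubT /= Es.
apply: (sorted_eq rawty_le_trans rawty_le_anti) => //.
  exact: sort_sorted rawty_le_total _.
by rewrite perm_sort -[X in perm_eq _ X]E; apply: perm_map; apply: perm_eq_seq_mset.
Qed.

Lemma Arr_surj (L : lty) : exists M N, L = Arr M N.
Proof.
case: L => -[M N] HL; have /and4P[sM sN cM cN] := HL.
have [M' EM] := raw_mset_surj sM cM; have [N' EN] := raw_mset_surj sN cN.
by exists M', N'; apply: val_inj; rewrite /= EM EN.
Qed.

Lemma lty_ind (P : lty -> Prop) :
  (forall M N, (forall L, L \in M -> P L) -> (forall L, L \in N -> P L) ->
     P (Arr M N)) ->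
  forall L, P L.
Proof.
move=> IH; suff H r : forall L, raw_of L = r -> P L by move=> L; apply: (H _ L).
elim/rawty_nested_ind: r => M N HM HN L; have [M' [N' ->]] := Arr_surj L.
have mem s M0 : rawty_all (fun r => forall L0, raw_of L0 = r -> P L0) s ->
  raw_mset M0 = s -> forall L0, L0 \in M0 -> P L0.
  move=> Hs Es L0 L0M; have {L0M} : raw_of L0 \in s.
    by rewrite -Es mem_sort; apply: map_f; rewrite -(perm_mem (perm_eq_seq_mset _)) seq_mset_id.
  elim: s Hs {Es} => //= r s IHs [Hr /IHs Hs]; rewrite inE.
  by case/orP=> [/eqP /Hr|/Hs].
by case=> EM EN; apply: IH; [apply: mem EM | apply: mem EN].
Qed.

(* Type contexts; index [x] is mapped to [G x]. *)
Notation tctx := {fsfun nat -> mty with mset0}.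

Definition ctx_dom (G : tctx) : {fset nat} := finsupp G.

Definition ctx0 : tctx := [fsfun].

Definition ctx1 (x : nat) (M : mty) : tctx := [fsfun ctx0 with x |-> M].

Definition ctxU (G P : tctx) : tctx :=
  [fsfun x in (finsupp G `|` finsupp P)%fset => (G x `+` P x)%mset].

(* The context (G, x : N) for the body of a binder of x: x is index 0, which is
   not in the domain of the shift of [G] under the binder. *)
Definition ctx_cons (N : mty) (G : tctx) : tctx :=
  [fsfun x in (0 |` [fset y.+1 | y in finsupp G])%fset =>
     if x is y.+1 then G y else N].

Lemma ctx0E x : ctx0 x = mset0.
Proof. by rewrite fsfun0E. Qed.

Lemma ctx1E x M y : ctx1 x M y = if y == x then M else mset0.
Proof. by rewrite fsfun_withE ctx0E. Qed.

Lemma ctxUE G P x : ctxU G P x = (G x `+` P x)%mset.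
Proof.
rewrite fsfun_fun in_fsetU; case: finsuppP => //= _.
by case: finsuppP => //= _; rewrite msetD0.
Qed.

Lemma ctx_consE N G x : ctx_cons N G x = if x is y.+1 then G y else N.
Proof.
rewrite fsfun_fun in_fset1U; case: x => [|y] //=.
case: ifP => // /negbT Hy; rewrite fsfun_dflt //; apply: contra Hy => Hy.
by apply/imfsetP; exists y.
Qed.

(* [ltyping G m e t L] and [mtyping G m e t M] are the judgements
   G |-(m,e) t : L for a linear type L and G |-(m,e) t : M for a multi type M. *)
Inductive ltyping : tctx -> nat -> nat -> term -> lty -> Prop :=
| TFun G m e t N M :
    mtyping (ctx_cons N G) m e t M ->
    ltyping G m e (Lam t) (Arr N M)
with mtyping : tctx -> nat -> nat -> term -> mty -> Prop :=
| TAx x M :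
    mtyping (ctx1 x M) 0 1 (Var x) M
| TApp G P m e m' e' t s M N :
    mtyping G m e t [mset Arr M N]%mset ->
    mtyping P m' e' s M ->
    mtyping (ctxU G P) (m + m' + 1) (e + e') (App t s) N
| TMany (J : finType) (P : J -> tctx) (m e : J -> nat) (t : term) (L : J -> lty) :
    (forall i, ltyping (P i) (m i) (e i) (Lam t) (L i)) ->
    mtyping (\big[ctxU/ctx0]_(i : J) P i) (\sum_(i : J) m i) (\sum_(i : J) e i)
            (Lam t) (seq_mset [seq L i | i : J])
| TES G P m e m' e' t s M N :
    mtyping (ctx_cons N G) m e t M ->
    mtyping P m' e' s N ->
    mtyping (ctxU G P) (m + m') (e + e') (ES t s) M.

Definition tight G m e t M (Phi : mtyping G m e t M) : Prop :=
  M = mset0 /\ ctx_dom G = fset0.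

(* Main.v *)
(** Every step consumes its own rule: a multiplicative step removes exactly one
    (app) rule and an exponential step exactly one (ax) rule, because weak
    contexts reach only positions that are typed exactly once.  Hence reduction
    from a typed term terminates, within the two counters.  It can only stop on
    a normal term or on a free variable in weak position, and the latter is
    excluded by closedness.  A normal term of type [0] uses neither rule, so in
    the tight case the counters are used up. *)
Require Import Defs.
From mathcomp Require Import all_boot finmap multiset.
From mathcomp Require Import zify.

Set Implicit Arguments.
Unset Strict Implicit.
Unset Printing Implicit Defensive.

Local Open Scope nat_scope.

(** * Shifting *)

Lemma shift0 c t : shift 0 c t = t.
Proof.
elim: t c => [i|t IH|t IHt s IHs|t IHt s IHs] c /=; rewrite ?IH ?IHt ?IHs //.
by rewrite addn0 if_same.
Qed.

Lemma shift_shift k c t : shift k c (shift 1 c t) = shift k.+1 c t.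
Proof.
elim: t c => [i|t IH|t IHt s IHs|t IHt s IHs] c /=; rewrite ?IH ?IHt ?IHs //.
by congr Var; do !case: ifP; lia.
Qed.

Lemma cshift0 c V : cshift 0 c V = V.
Proof. by elim: V c => //= [V IH t|V IH t|t V IH|t V IH] c; rewrite IH shift0. Qed.

Lemma cshift_cshift k c V : cshift k c (cshift 1 c V) = cshift k.+1 c V.
Proof.
by elim: V c => //= [V IH t|V IH t|t V IH|t V IH] c; rewrite IH shift_shift.
Qed.

Lemma cdepth_cshift k c V : cdepth (cshift k c V) = cdepth V.
Proof. by elim: V c => //= V IH t c; rewrite IH. Qed.

Lemma shift_cplug k c V t :
  shift k c (cplug V t) = cplug (cshift k c V) (shift k (c + cdepth V) t).
Proof.
by elim: V c => [|V IH s|V IH s|s V IH|s V IH] c /=;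
  rewrite ?addn0 ?IH ?addSnnS.
Qed.

Lemma shift_cplug_nc_var k V :
  shift k 1 (cplug_nc V (Var 0)) = cplug_nc (cshift k 1 V) (Var 0).
Proof. by rewrite /cplug_nc shift_cplug cdepth_cshift /= add0n add1n ltnSn. Qed.

Lemma fv_shift1 c t x : fv (shift 1 c t) (bump c x) = fv t x.
Proof.
elim: t c x => [i|t IH|t IHt s IHs|t IHt s IHs] c x /=;
  rewrite -?bumpS ?IH ?IHt ?IHs //.
by rewrite /bump; case: ltnP; case: leqP; lia.
Qed.

(** The only constructor that binds at the hole; through the others, non-capturing plugging commutes
    by computation. *)
Lemma cplug_nc_CESL V s t :
  cplug_nc (CESL V s) t = ES (cplug_nc V (shift 1 0 t)) s.
Proof. by rewrite /cplug_nc /= shift_shift. Qed.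

(* Root steps at a distance decompose into steps with an empty substitution
   context by commuting the argument out of its substitutions one by one. *)
Lemma root_m_elim (P : term -> term -> Prop) :
  (forall t s, P (App (Lam t) s) (ES t s)) ->
  (forall t u s r, P (App t (shift 1 0 s)) r -> P (App (ES t u) s) (ES r u)) ->
  forall t s, root_m t s -> P t s.
Proof.
move=> P0 PS _ _ [S t s]; elim: S s => [|S IH u] s /=; first by rewrite shift0.
by rewrite -shift_shift; apply/PS/IH.
Qed.

(** Once [u] is commuted out, [t] lies under its binder; the cutoff in [shift 1 1 t] keeps index 0,
    the variable to be replaced. *)
Lemma root_e_elim (P : term -> term -> Prop) :
  (forall V v, is_value v ->
     P (ES (cplug_nc V (Var 0)) v) (ES (cplug_nc V (shift 1 0 v)) v)) ->
  (forall t u s r, P (ES (shift 1 1 t) s) r -> P (ES t (ES s u)) (ES r u)) ->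
  forall t s, root_e t s -> P t s.
Proof.
move=> P0 PS _ _ [V S v Hv]; elim: S V => [|S IH u] V /=.
  by rewrite cshift0; apply: P0.
by rewrite -cshift_cshift; apply: PS; rewrite shift_cplug_nc_var; apply: IH.
Qed.

(** * Free variables along reduction *)

Lemma fv_cplug V t s x :
  (forall y, fv s y -> fv t y) -> fv (cplug V s) x -> fv (cplug V t) x.
Proof.
move=> H; elim: V x => [|V IH u|V IH u|u V IH|u V IH] x /=; first exact: H.
- by case/orP=> [/IH->|->]; rewrite ?orbT.
- by case/orP=> [/IH->|->]; rewrite ?orbT.
- by case/orP=> [->|/IH->]; rewrite ?orbT.
- by case/orP=> [->|/IH->]; rewrite ?orbT.
Qed.

(** Without capture, a free variable comes either from [s] or from [V] itself, and then it stays
    whatever is plugged. *)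
Lemma fv_cplug_nc V t s x :
  fv (cplug_nc V s) x -> fv (cplug_nc V t) x || fv s x.
Proof.
elim: V t s x => [|V IH u|V IH u|u V IH|u V IH] t s x.
- by rewrite /cplug_nc !shift0 => ->; rewrite orbT.
- by move: (IH t s x); rewrite /cplug_nc /= => H /orP[/H/orP[]|] ->; rewrite ?orbT.
- rewrite !cplug_nc_CESL /= => /orP[/IH-/(_ (shift 1 0 t))|->]; last by rewrite orbT.
  by rewrite -[x.+1]/(bump 0 x) fv_shift1 => /orP[]->; rewrite ?orbT.
- by move: (IH t s x); rewrite /cplug_nc /= => H /orP[|/H/orP[]] ->; rewrite ?orbT.
- by move: (IH t s x); rewrite /cplug_nc /= => H /orP[|/H/orP[]] ->; rewrite ?orbT.
Qed.

Lemma fv_root_m t s : root_m t s -> forall x, fv s x -> fv t x.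
Proof.
elim/root_m_elim=> //= t' u s' r IH x /orP[/IH|->]; last by rewrite orbT.
by rewrite -[in X in _ || X]/(bump 0 x) fv_shift1 => /orP[]->; rewrite ?orbT.
Qed.

Lemma fv_root_e t s : root_e t s -> forall x, fv s x -> fv t x.
Proof.
elim/root_e_elim=> /= [V v _ x|t' u s' r IH x].
  case/orP=> [/fv_cplug_nc-/(_ (Var 0))|->]; last by rewrite orbT.
  by rewrite -[in X in _ || X]/(bump 0 x) fv_shift1.
case/orP=> [/IH|->]; last by rewrite !orbT.
by rewrite -[x.+2]/(bump 1 x.+1) fv_shift1 => /orP[]->; rewrite ?orbT.
Qed.

Lemma closed_cbv_m t s : cbv_m t s -> closed_term t -> closed_term s.
Proof.
case=> V {}t {}s /fv_root_m H ht x; apply: contra (ht x); exact: fv_cplug.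
Qed.

Lemma closed_cbv_e t s : cbv_e t s -> closed_term t -> closed_term s.
Proof.
case=> V {}t {}s /fv_root_e H ht x; apply: contra (ht x); exact: fv_cplug.
Qed.

(** * Progress *)

(** Gives the shape that both root rules ask for, on the left of an application and inside a
    substitution. *)
Lemma normal_splug t : normal_cbv t -> exists S u, t = splug S (Lam u).
Proof.
elim=> [u|{}t s _ [S [u ->]] _ _]; first by exists SHole, u.
by exists (SES S s), u.
Qed.

Lemma cplug_cons_m (K : term -> term) :
  (forall V, exists V', forall t, K (cplug V t) = cplug V' t) ->
  forall t s, cbv_m t s -> cbv_m (K t) (K s).
Proof. by move=> HK _ _ [V t s H]; have [V' E] := HK V; rewrite !E; constructor. Qed.

Lemma cplug_cons_e (K : term -> term) :
  (forall V, exists V', forall t, K (cplug V t) = cplug V' t) ->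
  forall t s, cbv_e t s -> cbv_e (K t) (K s).
Proof. by move=> HK _ _ [V t s H]; have [V' E] := HK V; rewrite !E; constructor. Qed.

Definition reducible (t : term) : Prop := exists s, cbv_m t s \/ cbv_e t s.

Lemma reducible_cons (K : term -> term) :
  (forall V, exists V', forall t, K (cplug V t) = cplug V' t) ->
  forall t, reducible t -> reducible (K t).
Proof.
move=> HK t [s [H|H]]; exists (K s); [left|right].
- exact: cplug_cons_m H.
- exact: cplug_cons_e H.
Qed.

(** The third case is a term waiting for [x] in weak position; the cases may overlap. In an
    application the left subterm alone decides, since a multiplicative step accepts any argument. *)
Lemma progress t :
  [\/ reducible t, normal_cbv t | exists V x, t = cplug_nc V (Var x)].
Proof.
elim: t => [x|t _|t IHt s _|t IHt s IHs].
- by apply: Or33; exists CHole, x; rewrite /cplug_nc shift0.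
- by apply: Or32; constructor.
- case: IHt => [Ht|/normal_splug[S [u ->]]|[V [x ->]]].
  + apply: Or31; apply: (@reducible_cons (App^~ s) _ _ Ht) => V.
    by exists (CAppL V s).
  + by apply: Or31; eexists; left; apply: (CbvM CHole (RootM S u s)).
  + by apply: Or33; exists (CAppL V s), x.
case: IHs => [Hs|Hs|[V [x ->]]]; last by apply: Or33; exists (CESR t V), x.
  by apply: Or31; apply: reducible_cons Hs => V; exists (CESR t V).
(* Here [s] is normal. Index 0 is bound by this very substitution, so waiting for it yields an
   exponential redex; index [x.+1] is [x] outside. *)
case: IHt => [Ht|Ht|[V [[|x] ->]]].
- apply: Or31; apply: (@reducible_cons (ES^~ s) _ _ Ht) => V.
  by exists (CESL V s).
- by apply: Or32; constructor.
- have [S [u ->]] := normal_splug Hs; apply: Or31.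
  by eexists; right; apply: (CbvE CHole (RootE V S (value_lam u))).
- by apply: Or33; exists (CESL V s), x; rewrite cplug_nc_CESL /= addn1.
Qed.

Lemma fv_cplug_nc_var V x : fv (cplug_nc V (Var x)) x.
Proof.
elim: V x => [|V IH u|V IH u|u V IH|u V IH] x.
- by rewrite /cplug_nc shift0 /=.
- exact/orP/or_introl/IH.
- by rewrite cplug_nc_CESL /= addn1 IH.
- exact/orP/or_intror/IH.
- exact/orP/or_intror/IH.
Qed.

Lemma closed_progress t : closed_term t -> reducible t \/ normal_cbv t.
Proof.
move=> ht; case: (progress t) => [||[V [x E]]]; [by left | by right |].
by move: (ht x); rewrite E fv_cplug_nc_var.
Qed.

(** * Type contexts *)

Lemma ctxUC : commutative ctxU.
Proof. by move=> G P; apply/fsfunP => x; rewrite !ctxUE msetDC. Qed.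

Lemma ctxUA : associative ctxU.
Proof. by move=> G P Q; apply/fsfunP => x; rewrite !ctxUE msetDA. Qed.

Lemma ctx0U : left_id ctx0 ctxU.
Proof. by move=> G; apply/fsfunP => x; rewrite ctxUE ctx0E mset0D. Qed.

Lemma ctxU0 : right_id ctx0 ctxU.
Proof. by move=> G; rewrite ctxUC ctx0U. Qed.

Lemma ctxUCA : left_commutative ctxU.
Proof. by move=> G P Q; rewrite ctxUA (ctxUC G) -ctxUA. Qed.

Lemma ctxUAC : right_commutative ctxU.
Proof. by move=> G P Q; rewrite -ctxUA (ctxUC P) ctxUA. Qed.

Lemma ctxU_cons M N G P :
  ctxU (ctx_cons M G) (ctx_cons N P) = ctx_cons (M `+` N)%mset (ctxU G P).
Proof. by apply/fsfunP => -[|x]; rewrite !(ctxUE, ctx_consE). Qed.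

Lemma ctx_cons_inj M N G P : ctx_cons M G = ctx_cons N P -> M = N /\ G = P.
Proof.
move=> E; split; first by move/fsfunP: E => /(_ 0); rewrite !ctx_consE.
by apply/fsfunP => x; move/fsfunP: E => /(_ x.+1); rewrite !ctx_consE.
Qed.

Lemma ctx_cons0 : ctx_cons mset0 ctx0 = ctx0.
Proof. by apply/fsfunP => -[|x]; rewrite ctx_consE !ctx0E. Qed.

Definition ctx_tail (G : tctx) : tctx :=
  [fsfun x in [fset y.-1 | y in finsupp G]%fset => G x.+1].

Lemma ctx_cons_tail (G : tctx) : ctx_cons (G 0) (ctx_tail G) = G.
Proof.
apply/fsfunP => -[|x]; rewrite ctx_consE // fsfun_fun.
case: ifP => // /negbT Hx; rewrite fsfun_dflt //; apply: contra Hx => Hx.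
by apply/imfsetP; exists x.+1.
Qed.

(** Counterpart of [shift 1 c] on contexts: [c] is outside the image of [bump c], so the inserted
    variable gets the default [mset0]. *)
Definition ctx_insert (c : nat) (G : tctx) : tctx :=
  [fsfun x in [fset bump c y | y in finsupp G]%fset => G (unbump c x)].

Lemma ctx_insertE c (G : tctx) x :
  ctx_insert c G x = if x == c then mset0 else G (unbump c x).
Proof.
rewrite fsfun_fun; case: ifP => [/imfsetP[y _ ->]|/negbT Hx].
  by rewrite eq_sym (negbTE (neq_bump c y)).
case: eqP => // /eqP ne; rewrite fsfun_dflt //; apply: contra Hx => Hx.
by apply/imfsetP; exists (unbump c x); rewrite // unbumpKcond (negbTE ne).
Qed.

Lemma ctx_insert0 G : ctx_insert 0 G = ctx_cons mset0 G.
Proof.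
by apply/fsfunP => -[|x]; rewrite ctx_insertE ctx_consE //= /unbump /= subn1.
Qed.

Lemma ctx_insert_cons c N G :
  ctx_insert c.+1 (ctx_cons N G) = ctx_cons N (ctx_insert c G).
Proof.
apply/fsfunP => -[|x]; rewrite ctx_insertE !ctx_consE //.
by rewrite ctx_insertE eqSS unbumpS.
Qed.

Lemma ctx_insert_ctx0 c : ctx_insert c ctx0 = ctx0.
Proof. by apply/fsfunP => x; rewrite ctx_insertE !ctx0E if_same. Qed.

Lemma ctx_insertU c G P :
  ctx_insert c (ctxU G P) = ctxU (ctx_insert c G) (ctx_insert c P).
Proof.
by apply/fsfunP => x; rewrite !(ctxUE, ctx_insertE); case: eqP; rewrite ?msetD0.
Qed.

Lemma ctx_insert1 c x M : ctx_insert c (ctx1 x M) = ctx1 (bump c x) M.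
Proof.
apply/fsfunP => y; rewrite ctx_insertE !ctx1E.
case: eqP => [->|ne]; first by rewrite (negbTE (neq_bump c x)).
by rewrite -(inj_eq (can_inj (bumpK c))) unbumpK //; apply/eqP.
Qed.

Lemma ctx1S x M : ctx1 x.+1 M = ctx_cons mset0 (ctx1 x M).
Proof. by rewrite -ctx_insert0 ctx_insert1. Qed.

Lemma ctx1_0 M : ctx1 0 M = ctx_cons M ctx0.
Proof. by apply/fsfunP => -[|x]; rewrite ctx_consE !ctx1E // ctx0E. Qed.

(** Since [ctx1 x.+1 N1] is empty at index 0, the type of the bound variable lies wholly in [G'],
    and the equation can leave the scope of the binder. *)
Lemma ctx_cons_eqU1 N G x N1 G' :
  ctx_cons N G = ctxU (ctx1 x.+1 N1) G' ->
  exists2 G1, G' = ctx_cons N G1 & G = ctxU (ctx1 x N1) G1.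
Proof.
rewrite ctx1S -{1}(ctx_cons_tail G') ctxU_cons => /ctx_cons_inj[].
by rewrite mset0D => -> ->; exists (ctx_tail G'); rewrite ?ctx_cons_tail.
Qed.

(** * Typing of abstractions *)

(** Rule (many) with (fun) inlined, its premises being listed one by one instead of indexed by a
    finite type, so that induction applies. *)
Inductive lam_typing (t : term) : tctx -> nat -> nat -> mty -> Prop :=
| LamNil : lam_typing t ctx0 0 0 mset0
| LamCons G m e N M P m' e' M' :
    mtyping (ctx_cons N G) m e t M -> lam_typing t P m' e' M' ->
    lam_typing t (ctxU G P) (m + m') (e + e') (Arr N M +` M')%mset.

Lemma seq_mset_nil (K : choiceType) : seq_mset [::] = mset0 :> {mset K}%mset.
Proof. by apply/msetP=> x; rewrite mset_seqE mset0E. Qed.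

Lemma ltyping_Arr G m e t N M :
  ltyping G m e (Lam t) (Arr N M) -> mtyping (ctx_cons N G) m e t M.
Proof.
move E: (Lam t) => u; move EL: (Arr N M) => L H.
by case: H E EL => G' m' e' t' N' M' H [->] /Arr_inj[-> ->].
Qed.

Lemma mtyping_lamE G m e t M : mtyping G m e (Lam t) M -> lam_typing t G m e M.
Proof.
move E: (Lam t) => u H; case: H E => // J P {}m {}e {}t' L HL [E].
(* The multi type is enumerated by the same list as the big operators, so that this list can be
   generalized and inducted on. *)
have -> : [seq L i | i : J] = map L (index_enum J).
  by rewrite [index_enum J]unlock -enumT.
elim: (index_enum J) => [|i s IH] /=.
  by rewrite !big_nil seq_mset_nil; constructor.
rewrite !big_cons mset_cons.
have := HL i; have [N [N' ->]] := Arr_surj (L i); rewrite -E => /ltyping_Arr Hi.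
exact: LamCons.
Qed.

Lemma lam_typing_mtyping G m e t M : lam_typing t G m e M -> mtyping G m e (Lam t) M.
Proof.
move=> H.
(* The families are total functions on [nat], relevant below [n], so that prepending a premise is a
   case analysis on the index. *)
suff [n [P [mm [ee [L [HL -> -> -> ->]]]]]] :
    exists n (P : nat -> tctx) (mm ee : nat -> nat) (L : nat -> lty),
    [/\ forall i, i < n -> ltyping (P i) (mm i) (ee i) (Lam t) (L i),
        G = \big[ctxU/ctx0]_(i < n) P i, m = \sum_(i < n) mm i,
        e = \sum_(i < n) ee i & M = seq_mset [seq L i | i : 'I_n]].
  exact: (TMany (fun i : 'I_n => HL i (ltn_ord i))).
elim: H => [|{}G {}m {}e N {}M P m' e' M' H _ [n [P' [mm [ee [L [HL -> -> -> ->]]]]]]].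
  exists 0, (fun=> ctx0), (fun=> 0), (fun=> 0), (fun=> Arr mset0 mset0).
  by split; rewrite ?big_ord0 // /image_mem enum_ord0 seq_mset_nil.
exists n.+1, (fun i => if i is j.+1 then P' j else G),
  (fun i => if i is j.+1 then mm j else m),
  (fun i => if i is j.+1 then ee j else e),
  (fun i => if i is j.+1 then L j else Arr N M).
split; rewrite ?big_ord_recl //; first by case=> [_|i /HL //]; apply: TFun.
by rewrite /image_mem enum_ordSl /= mset_cons -map_comp.
Qed.

Lemma mset_cons_eqD (L : lty) (M M1 M2 : mty) :
  (L +` M = M1 `+` M2)%mset ->
  (exists2 M1', M1 = L +` M1' & M = M1' `+` M2)%mset \/
  (exists2 M2', M2 = L +` M2' & M = M1 `+` M2')%mset.
Proof.
move=> E; have: L \in (M1 `+` M2)%mset by rewrite -E mset1D1.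
rewrite in_msetD => /orP[/msetB1K EM|/msetB1K EM]; [left|right].
- exists (M1 `\ L)%mset => //; move: E; rewrite -{1}EM -msetDA.
  exact: can_inj (msetDKB _) _ _.
- exists (M2 `\ L)%mset => //; move: E; rewrite -{1}EM msetDCA.
  exact: can_inj (msetDKB _) _ _.
Qed.

(** Each premise proves one linear type and follows it into [M1] or [M2], taking its context and
    counters along. *)
Lemma lam_typing_split t G m e M1 M2 :
  lam_typing t G m e (M1 `+` M2)%mset ->
  exists G1 m1 e1 G2 m2 e2,
  [/\ lam_typing t G1 m1 e1 M1, lam_typing t G2 m2 e2 M2,
      G = ctxU G1 G2, m = m1 + m2 & e = e1 + e2].
Proof.
move EM: (M1 `+` M2)%mset => M H.
elim: H M1 M2 EM => [|{}G {}m {}e N M0 P m' e' M' H _ IH] M1 M2 EM.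
  have [-> ->] : M1 = mset0 /\ M2 = mset0.
    by split; apply/msetP => L; move/msetP: EM => /(_ L); rewrite msetE2 !mset0E; lia.
  exists ctx0, 0, 0, ctx0, 0, 0; split; by [constructor | rewrite ctx0U].
case: (mset_cons_eqD (esym EM)) => -[M0' ->
   /esym/IH[G1 [m1 [e1 [G2 [m2 [e2 [H1 H2 -> -> ->]]]]]]]].
- exists (ctxU G G1), (m + m1), (e + e1), G2, m2, e2.
  by split; rewrite ?ctxUA ?addnA //; apply: LamCons.
- exists G1, m1, e1, (ctxU G G2), (m + m2), (e + e2).
  by split; rewrite ?(ctxUCA G1) 1?(addnCA m1) 1?(addnCA e1) //; apply: LamCons.
Qed.

Lemma lam_typing0 t G m e M :
  lam_typing t G m e M -> M = mset0 -> [/\ G = ctx0, m = 0 & e = 0].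
Proof.
case=> // {}G {}m {}e N M0 P m' e' M' _ _ /msetP/(_ (Arr N M0)).
by rewrite mset1DE eqxx mset0E.
Qed.

Lemma lam_typing1 t G m e N M :
  lam_typing t G m e [mset Arr N M]%mset -> mtyping (ctx_cons N G) m e t M.
Proof.
move EL: [mset Arr N M]%mset => A H.
case: H EL => [/msetP/(_ (Arr N M))|{}G {}m {}e N' M0 P m' e' M' H H' E].
  by rewrite msetnE eqxx mset0E.
have EL : Arr N M = Arr N' M0.
  have: Arr N' M0 \in [mset Arr N M]%mset by rewrite E in_mset1D eqxx.
  by rewrite in_mset1 => /eqP.
move: E; rewrite EL -[X in X = _]msetD0 => /(can_inj (msetDKB _)) E.
case/Arr_inj: EL => -> ->.
by have [-> -> ->] := lam_typing0 H' (esym E); rewrite ctxU0 !addn0.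
Qed.

(** Makes duplicating a value free: one part types the copy put in place of the variable, the other
    the value left in the substitution. *)
Lemma mtyping_split v G m e M1 M2 : is_value v ->
  mtyping G m e v (M1 `+` M2)%mset ->
  exists G1 m1 e1 G2 m2 e2,
  [/\ mtyping G1 m1 e1 v M1, mtyping G2 m2 e2 v M2,
      G = ctxU G1 G2, m = m1 + m2 & e = e1 + e2].
Proof.
case=> t /mtyping_lamE/lam_typing_split[G1 [m1 [e1 [G2 [m2 [e2 [H1 H2 -> -> ->]]]]]]].
by exists G1, m1, e1, G2, m2, e2; split=> //; apply: lam_typing_mtyping.
Qed.

(** * Inversion and weakening of derivations *)

Lemma mtyping_VarE G m e x M :
  mtyping G m e (Var x) M -> [/\ G = ctx1 x M, m = 0 & e = 1].
Proof. by move E: (Var x) => u H; case: H E => // y N [->]. Qed.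

Lemma mtyping_AppE G m e t s N : mtyping G m e (App t s) N ->
  exists G1 m1 e1 G2 m2 e2 M,
  [/\ mtyping G1 m1 e1 t [mset Arr M N]%mset, mtyping G2 m2 e2 s M
    & [/\ G = ctxU G1 G2, m = m1 + m2 + 1 & e = e1 + e2]].
Proof.
move E: (App t s) => u H; case: H E => // G1 G2 m1 e1 m2 e2 t' s' M N' H1 H2 [-> ->].
by exists G1, m1, e1, G2, m2, e2, M.
Qed.

Lemma mtyping_ESE G m e t s M : mtyping G m e (ES t s) M ->
  exists G1 m1 e1 G2 m2 e2 N,
  [/\ mtyping (ctx_cons N G1) m1 e1 t M, mtyping G2 m2 e2 s N
    & [/\ G = ctxU G1 G2, m = m1 + m2 & e = e1 + e2]].
Proof.
move E: (ES t s) => u H; case: H E => // G1 G2 m1 e1 m2 e2 t' s' M' N H1 H2 [-> ->].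
by exists G1, m1, e1, G2, m2, e2, N.
Qed.

(** The inserted variable has type [mset0], so the derivation keeps its rules and counters. *)
Lemma mtyping_shift c t G m e M :
  mtyping G m e t M -> mtyping (ctx_insert c G) m e (shift 1 c t) M.
Proof.
elim: t c G m e M => [x|t IH|t IHt s IHs|t IHt s IHs] c G m e M.
- case/mtyping_VarE=> -> -> ->; rewrite ctx_insert1.
  suff -> : shift 1 c (Var x) = Var (bump c x) by constructor.
  by rewrite /= /bump; case: ltnP; rewrite /= ?addn1 ?add0n.
- move/mtyping_lamE=> H; apply: lam_typing_mtyping.
  elim: H => [|{}G {}m {}e N {}M P m' e' M' H _ IH'].
    by rewrite ctx_insert_ctx0; constructor.
  by rewrite ctx_insertU; apply: LamCons IH'; rewrite -ctx_insert_cons; apply: IH.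
- case/mtyping_AppE=> G1 [m1 [e1 [G2 [m2 [e2 [N [H1 H2 [-> -> ->]]]]]]]].
  by rewrite ctx_insertU; apply: TApp (IHt _ _ _ _ _ H1) (IHs _ _ _ _ _ H2).
- case/mtyping_ESE=> G1 [m1 [e1 [G2 [m2 [e2 [N [H1 H2 [-> -> ->]]]]]]]].
  rewrite ctx_insertU; apply: TES (IHs _ _ _ _ _ H2).
  by rewrite -ctx_insert_cons; apply: IHt.
Qed.

(** * Quantitative subject reduction *)

(** In the base case, (app) and the (many) and (fun) typing its function give way to one (ES), which
    adds nothing to the counters: hence a loss of exactly 1. *)
Lemma mtyping_root_m t s : root_m t s ->
  forall G m e M, mtyping G m e t M -> exists2 m', m = m'.+1 & mtyping G m' e s M.
Proof.
elim/root_m_elim => {t s} [t s|t u s r IH] G m e M.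
  case/mtyping_AppE=> G1 [m1 [e1 [G2 [m2 [e2 [N [H1 H2 [-> -> ->]]]]]]]].
  exists (m1 + m2); first by rewrite addn1.
  by apply: TES H2; apply/lam_typing1/mtyping_lamE.
case/mtyping_AppE=> G0 [m0 [e0 [G2 [m2 [e2 [N [/mtyping_ESE Htu Hs [-> -> ->]]]]]]]].
case: Htu => G1 [m1 [e1 [G3 [m3 [e3 [N' [Ht Hu [-> -> ->]]]]]]]].
(* The shifted argument does not use the binder of [u], whose type stays [N']; so (ES) can be
   rebuilt outside the application. *)
have := TApp Ht (mtyping_shift 0 Hs).
rewrite ctx_insert0 ctxU_cons msetD0 => /IH[m' Em Hr].
exists (m' + m3); first by lia.
by rewrite ctxUAC addnAC; apply: TES Hr Hu.
Qed.

(** The hole is under no abstraction, so its variable is typed by a single (ax), at some [N].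
    Replacing it by a derivation of [s] at [N] trades its counters (0,1) for those of [s]; [G']
    types the rest, including other occurrences of [x]. *)
Lemma mtyping_cplug_nc_var V x G m e M :
  mtyping G m e (cplug_nc V (Var x)) M ->
  exists N G' e', [/\ G = ctxU (ctx1 x N) G', e = e'.+1 &
    forall s P m1 e1, mtyping P m1 e1 s N ->
    mtyping (ctxU G' P) (m + m1) (e' + e1) (cplug_nc V s) M].
Proof.
elim: V x G m e M => [|V IH u|V IH u|u V IH|u V IH] x G m e M.
- rewrite /cplug_nc shift0 => /mtyping_VarE[-> -> ->].
  exists M, ctx0, 0; split=> [||s P m1 e1 Hs]; rewrite ?ctxU0 //.
  by rewrite ctx0U shift0 /=.
- case/mtyping_AppE=> G1 [m1 [e1 [G2 [m2 [e2 [N [H1 H2 [-> -> ->]]]]]]]].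
  have [N' [G' [e' [-> -> H]]]] := IH _ _ _ _ _ H1.
  exists N', (ctxU G' G2), (e' + e2); split=> [||s P m3 e3 Hs]; rewrite ?ctxUA //.
  by rewrite ctxUAC !(addnAC _ 1) (addnAC _ m2) (addnAC _ e2); apply: TApp (H _ _ _ _ Hs) H2.
- rewrite cplug_nc_CESL /= addn1.
  case/mtyping_ESE=> G1 [m1 [e1 [G2 [m2 [e2 [N [H1 H2 [-> -> ->]]]]]]]].
  have [N' [_ [e' [/ctx_cons_eqU1[G' -> ->] -> H]]]] := IH _ _ _ _ _ H1.
  exists N', (ctxU G' G2), (e' + e2); split=> [||s P m3 e3 Hs]; rewrite ?ctxUA //.
  rewrite cplug_nc_CESL ctxUAC (addnAC _ m2) (addnAC _ e2); apply: TES H2.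
  have := H _ _ _ _ (mtyping_shift 0 Hs).
  by rewrite ctx_insert0 ctxU_cons msetD0.
- case/mtyping_AppE=> G1 [m1 [e1 [G2 [m2 [e2 [N [H1 H2 [-> -> ->]]]]]]]].
  have [N' [G' [e' [-> -> H]]]] := IH _ _ _ _ _ H2.
  exists N', (ctxU G1 G'), (e1 + e'); split=> [||s P m3 e3 Hs]; rewrite -?addnS //.
    by rewrite ctxUCA.
  by rewrite -ctxUA (addnAC _ 1) -(addnA m1) -(addnA e1); apply: TApp H1 (H _ _ _ _ Hs).
- case/mtyping_ESE=> G1 [m1 [e1 [G2 [m2 [e2 [N [H1 H2 [-> -> ->]]]]]]]].
  have [N' [G' [e' [-> -> H]]]] := IH _ _ _ _ _ H2.
  exists N', (ctxU G1 G'), (e1 + e'); split=> [||s P m3 e3 Hs]; rewrite -?addnS //.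
    by rewrite ctxUCA.
  by rewrite -ctxUA -(addnA m1) -(addnA e1); apply: TES H1 (H _ _ _ _ Hs).
Qed.

Lemma mtyping_root_e t s : root_e t s ->
  forall G m e M, mtyping G m e t M -> exists2 e', e = e'.+1 & mtyping G m e' s M.
Proof.
elim/root_e_elim => {t s} [V v Hv|t u s r IH] G m e M.
  case/mtyping_ESE=> G1 [m1 [e1 [G2 [m2 [e2 [N [H1 H2 [-> -> ->]]]]]]]].
  have [N1 [G' [e' [EG -> H]]]] := mtyping_cplug_nc_var H1.
  (* At index 0, the type [N] of the bound variable splits into [N1], used by the replaced
     occurrence, and [G' 0], left for the others. *)
  move: EG H; rewrite -(ctx_cons_tail G') ctx1_0 ctxU_cons ctx0U.
  case/ctx_cons_inj=> EN -> H; move: H2; rewrite EN.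
  case/(mtyping_split Hv)=> P1 [m3 [e3 [P2 [m4 [e4 [Hv1 Hv2 -> -> ->]]]]]].
  have := H _ _ _ _ (mtyping_shift 0 Hv1).
  rewrite ctx_insert0 ctxU_cons msetD0 => H'.
  exists (e' + e3 + e4); first by lia.
  by rewrite ctxUA addnA; apply: TES H' Hv2.
case/mtyping_ESE=> G1 [m1 [e1 [G0 [m0 [e0 [N [Ht /mtyping_ESE Hsu [-> -> ->]]]]]]]].
case: Hsu => G2 [m2 [e2 [G3 [m3 [e3 [N' [Hs Hu [-> -> ->]]]]]]]].
(* Insertion at index 1 gives the binder of [u] type [mset0] and leaves the type [N] of the
   substituted variable at index 0. *)
have := mtyping_shift 1 Ht; rewrite ctx_insert_cons ctx_insert0 => Ht'.
have := TES Ht' Hs; rewrite ctxU_cons mset0D => /IH[e' Ee Hr].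
exists (e' + e3); first by lia.
by rewrite ctxUA addnA; apply: TES Hr Hu.
Qed.

Lemma mtyping_cbv_m t s : cbv_m t s ->
  forall G m e M, mtyping G m e t M -> exists2 m', m = m'.+1 & mtyping G m' e s M.
Proof.
case=> V {}t {}s /mtyping_root_m Hr.
elim: V => [|V IH u|V IH u|u V IH|u V IH] G m e M //=; first exact: Hr.
- case/mtyping_AppE=> G1 [m1 [e1 [G2 [m2 [e2 [N [H1 H2 [-> -> ->]]]]]]]].
  have [m' -> H] := IH _ _ _ _ H1.
  by exists (m' + m2 + 1); [lia | apply: TApp H H2].
- case/mtyping_ESE=> G1 [m1 [e1 [G2 [m2 [e2 [N [H1 H2 [-> -> ->]]]]]]]].
  have [m' -> H] := IH _ _ _ _ H1.
  by exists (m' + m2); [lia | apply: TES H H2].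
- case/mtyping_AppE=> G1 [m1 [e1 [G2 [m2 [e2 [N [H1 H2 [-> -> ->]]]]]]]].
  have [m' -> H] := IH _ _ _ _ H2.
  by exists (m1 + m' + 1); [lia | apply: TApp H1 H].
- case/mtyping_ESE=> G1 [m1 [e1 [G2 [m2 [e2 [N [H1 H2 [-> -> ->]]]]]]]].
  have [m' -> H] := IH _ _ _ _ H2.
  by exists (m1 + m'); [lia | apply: TES H1 H].
Qed.

Lemma mtyping_cbv_e t s : cbv_e t s ->
  forall G m e M, mtyping G m e t M -> exists2 e', e = e'.+1 & mtyping G m e' s M.
Proof.
case=> V {}t {}s /mtyping_root_e Hr.
elim: V => [|V IH u|V IH u|u V IH|u V IH] G m e M //=; first exact: Hr.
- case/mtyping_AppE=> G1 [m1 [e1 [G2 [m2 [e2 [N [H1 H2 [-> -> ->]]]]]]]].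
  have [e' -> H] := IH _ _ _ _ H1.
  by exists (e' + e2); [lia | apply: TApp H H2].
- case/mtyping_ESE=> G1 [m1 [e1 [G2 [m2 [e2 [N [H1 H2 [-> -> ->]]]]]]]].
  have [e' -> H] := IH _ _ _ _ H1.
  by exists (e' + e2); [lia | apply: TES H H2].
- case/mtyping_AppE=> G1 [m1 [e1 [G2 [m2 [e2 [N [H1 H2 [-> -> ->]]]]]]]].
  have [e' -> H] := IH _ _ _ _ H2.
  by exists (e1 + e'); [lia | apply: TApp H1 H].
- case/mtyping_ESE=> G1 [m1 [e1 [G2 [m2 [e2 [N [H1 H2 [-> -> ->]]]]]]]].
  have [e' -> H] := IH _ _ _ _ H2.
  by exists (e1 + e'); [lia | apply: TES H1 H].
Qed.

(** * Typing of normal forms and conclusion *)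

(** The body of a substitution has an empty context, so its bound variable, hence the substituted
    term, has type [mset0] and the induction goes on, down to abstractions without premises. *)
Lemma normal_mtyping0 t G m e : normal_cbv t ->
  mtyping G m e t mset0 -> [/\ G = ctx0, m = 0 & e = 0].
Proof.
move=> Ht; elim: Ht G m e => [u|{}t s _ IHt _ IHs] G m e.
  by move/mtyping_lamE/lam_typing0; apply.
case/mtyping_ESE=> G1 [m1 [e1 [G2 [m2 [e2 [N [/IHt[EG -> ->] H2 [-> -> ->]]]]]]]].
have [EN ->] := ctx_cons_inj (etrans EG (esym ctx_cons0)).
by move: H2; rewrite EN => /IHs[-> -> ->]; rewrite ctxU0.
Qed.

Theorem theorem3 (t : term) (G : tctx) (m e : nat) (M : mty)
    (ht : closed_term t) (Phi : mtyping G m e t M) :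
  exists (s : term) (d : cbv_seq t s),
    [/\ normal_cbv s,
        count_m d <= m,
        count_e d <= e
      & tight Phi -> count_m d = m /\ count_e d = e].
Proof.
(* [tight] speaks of a derivation, which changes along the evaluation; a condition on [M] is kept by
   subject reduction and passes through the induction. *)
suff [s [d [Hs Hm He Ht]]] : exists (s : term) (d : cbv_seq t s),
    [/\ normal_cbv s, count_m d <= m, count_e d <= e
      & M = mset0 -> count_m d = m /\ count_e d = e].
  by exists s, d; split=> // -[] /Ht.
have [n le_n] := ubnP (m + e).
elim: n m e t ht Phi le_n => // n IH m e t ht Phi le_n.
have [[u [Hu|Hu]]|Ht] := closed_progress ht.
- have [m' Em H] := mtyping_cbv_m Hu Phi.
  have [|s [d [Hs Hm He E]]] := IH m' e u (closed_cbv_m Hu ht) H; first by lia.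
  exists s, (SeqM Hu d); rewrite Em; split=> //= /E[-> ->]; by split.
- have [e' Ee H] := mtyping_cbv_e Hu Phi.
  have [|s [d [Hs Hm He E]]] := IH m e' u (closed_cbv_e Hu ht) H; first by lia.
  exists s, (SeqE Hu d); rewrite Ee; split=> //= /E[-> ->]; by split.
exists t, (SeqNil t); split=> //= EM; move: Phi; rewrite EM.
by case/(normal_mtyping0 Ht)=> _ -> ->.
Qed.
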